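(* Let $K$ be a kernel on $\mathbb{R}^d$ for which the condition ''$K\in L^1(\mathbb{R}^d\setminus B_r)$ for all $r>0$'' fails. Then $W^{K,p}(\mathbb{R}^d)=\{0\}$ for every $p\in[1,+\infty)$.
   Context: Here $d\ge1$ and $B_r$ is the open Euclidean ball of radius $r$ centred at the origin. A kernel is a measurable function $K:\mathbb{R}^d\to[0,+\infty]$ that is not a.e. equal to $0$. For $p\in[1,+\infty)$, $[u]_{W^{K,p}(\mathbb{R}^d)}:=\left(\int_{\mathbb{R}^d}\int_{\mathbb{R}^d}|u(x)-u(y)|^pK(x-y)\,dx\,dy\right)^{1/p}\in[0,+\infty]$ and $W^{K,p}(\mathbb{R}^d):=\{u\in L^p(\mathbb{R}^d):[u]_{W^{K,p}(\mathbb{R}^d)}<+\infty\}$ (functions identified when equal a.e.). *)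

(* Defs.v *)
From HB Require Import structures.
From mathcomp Require Import all_boot all_order all_algebra.
From mathcomp Require Import all_classical all_reals all_analysis.
From mathcomp Require Import measurable_realfun.

Set Implicit Arguments.
Unset Strict Implicit.
Unset Printing Implicit Defensive.
Import Order.TTheory GRing.Theory Num.Theory.
Import numFieldNormedType.Exports.

Local Open Scope classical_set_scope.
Local Open Scope ring_scope.

Section cons_measure.
Context {R : realType} {n : nat}.
Notation T := (measurableTypeR R).

Definition cons_pair (z : T * n.-tuple T) : n.+1.-tuple T :=
  [tuple of z.1 :: z.2].

Lemma measurable_cons_pair : measurable_fun setT cons_pair.
Proof. exact: measurable_cons. Qed.

Definition uncons (t : n.+1.-tuple T) : T * n.-tuple T :=
  (thead t, [tuple of behead t]).

Lemma measurable_uncons : measurable_fun setT uncons.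
Proof.
apply/measurable_fun_pairP; split; last exact: measurable_behead.
exact: measurable_tnth.
Qed.

Lemma cons_pairK : cancel cons_pair uncons.
Proof. by move=> [x t]; congr pair; exact/val_inj. Qed.

Lemma unconsK : cancel uncons cons_pair.
Proof. by move=> t; rewrite [RHS]tuple_eta. Qed.

Variable mu : {sigma_finite_measure set (n.-tuple T) -> \bar R}.

Definition cons_measure : set (n.+1.-tuple T) -> \bar R :=
  pushforward (lebesgue_measure \x mu)%E cons_pair.

Let cons_measure0 : cons_measure set0 = 0%E.
Proof. by rewrite /cons_measure /pushforward preimage_set0 measure0. Qed.

Let cons_measure_ge0 A : (0 <= cons_measure A)%E.
Proof. by rewrite /cons_measure /pushforward measure_ge0. Qed.

Let cons_measure_semi_sigma_additive : semi_sigma_additive cons_measure.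
Proof.
have mP A : measurable A -> measurable (cons_pair @^-1` A).
  by move=> mA; rewrite -[X in measurable X]setTI; exact: measurable_cons_pair.
move=> F mF tF mUF; rewrite /cons_measure /pushforward preimage_bigcup.
apply: measure_semi_sigma_additive.
- by move=> k; exact: mP.
- apply/trivIsetP => /= i j _ _ ij; rewrite -preimage_setI.
  by move/trivIsetP : tF => /(_ _ _ _ _ ij) ->//; rewrite preimage_set0.
- by rewrite -preimage_bigcup; exact: mP.
Qed.

HB.instance Definition _ := isMeasure.Build _ _ _ cons_measure
  cons_measure0 cons_measure_ge0 cons_measure_semi_sigma_additive.

Let cons_measure_sigma_finite : sigma_finite setT cons_measure.
Proof.
have [F FT mF] : sigma_finite setT (lebesgue_measure \x mu)%E.
  have /sigma_finiteP[F [TF ndF Foo]] := sigma_finiteT (@lebesgue_measure R).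
  have /sigma_finiteP[G [TG ndG Goo]] := sigma_finiteT mu.
  exists (fun k => F k `*` G k).
    rewrite -setXTT TF TG predeqE => -[x y]; split.
      move=> [/= [k _ Fkx] [l _ Gly]]; exists (maxn k l) => //; split.
      + by move: x Fkx; exact/subsetPset/ndF/leq_maxl.
      + by move: y Gly; exact/subsetPset/ndG/leq_maxr.
    by move=> [k _ []/= ? ?]; split; exists k.
  move=> k; have [? ?] := Foo k; have [? ?] := Goo k.
  split; first exact: measurableX.
  by rewrite product_measure1E// lte_mul_pinfty// ge0_fin_numE.
exists (fun i => uncons @^-1` F i); first by rewrite -preimage_bigcup -FT.
move=> i; have [mFi Fioo] := mF i; split.
  by rewrite -[X in measurable X]setTI; exact: measurable_uncons.
rewrite /cons_measure /pushforward -comp_preimage.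
rewrite (_ : uncons \o cons_pair = id) ?preimage_id//.
exact/funext/cons_pairK.
Qed.

HB.instance Definition _ := Measure_isSigmaFinite.Build _ _ _ cons_measure
  cons_measure_sigma_finite.

End cons_measure.

Section lebesgue_Rd.
Variable R : realType.
Notation T := (measurableTypeR R).

(* Product of d copies of the one-dimensional Lebesgue measure, on the product
   (= Borel) sigma-algebra of d.-tuple R; not yet complete. *)
Fixpoint borel_lebesgue (d : nat) :
    {sigma_finite_measure set (d.-tuple T) -> \bar R} :=
  match d with
  | 0 => \d_[tuple]
  | n.+1 => cons_measure (borel_lebesgue n)
  end.

Definition Rd (d : nat) := caratheodory_type (borel_lebesgue d)^*%mu.
HB.instance Definition _ d := Measurable.on (Rd d).

(* Lebesgue measurable sets as measurable sets, and the (complete)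
   d-dimensional Lebesgue measure: same construction as
   completed_lebesgue_measure. *)
Definition lebesgue_Rd (d : nat) : set (Rd d) -> \bar R :=
  @completed_measure_extension _ _ _ (borel_lebesgue d).
HB.instance Definition _ d := Measure.on (@lebesgue_Rd d).

Definition subRd (d : nat) (x y : Rd d) : Rd d :=
  [tuple tnth x i - tnth y i | i < d].

Definition enorm (d : nat) (x : Rd d) : R :=
  Num.sqrt (\sum_(i < d) tnth x i ^+ 2).

Definition Rd_ball (d : nat) (r : R) : set (Rd d) := [set x | enorm x < r].
End lebesgue_Rd.
Arguments lebesgue_Rd : clear implicits.
Arguments Rd_ball {R} d r.

Section nonlocal_space.
Local Open Scope ereal_scope.
Context {R : realType} {d : nat}.
Local Notation mu := (lebesgue_Rd R d).

Definition is_kernel (K : Rd R d -> \bar R) : Prop :=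
  [/\ measurable_fun setT K, forall x, 0 <= K x
    & ~ {ae mu, forall x, K x = 0}].

Definition seminormK (K : Rd R d -> \bar R) (p : R) (u : Rd R d -> R) : \bar R :=
  (\int[mu]_y \int[mu]_x
     ((`|u x - u y| `^ p)%R%:E * K (subRd x y))) `^ p^-1.

Definition WKp (K : Rd R d -> \bar R) (p : R) (p1 : 1 <= p%:E) :
    set (LspaceType mu p1) :=
  [set u | seminormK K p u < +oo].

Section Lspace0.
Variables (p : R) (p1 : 1 <= p%:E).
Notation Mmu := {mfun_ mu, Rd R d >-> measurableTypeR R}.

Definition mfun0 : Mmu := \pi_(Mmu)%qT (cst 0%R).

Let mfun0_ae : (mfun0 : _ -> _) = cst 0%R %[ae mu].
Proof.
have /eqmodP/asboolP : repr mfun0 = cst 0%R %[mod Mmu]%qT by rewrite reprK.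
by [].
Qed.

Let mfun0_finite_norm : finite_norm mu p%:E mfun0.
Proof.
have p0 : p != 0%R by rewrite gt_eqF// (lt_le_trans ltr01).
have mz : measurable_fun setT (EFin \o mfun0).
  by apply/measurable_EFinP; exact: (measurable_funPT (repr mfun0)).
rewrite /finite_norm unlock.
rewrite (@ge0_ae_eq_integral _ _ _ _ _ _ (cst 0))//.
- by rewrite integral0 poweR0r// invr_neq0.
- apply: (measurableT_comp (measurable_poweR p)).
  exact: (measurableT_comp _ mz).
- by move=> x _; exact: poweR_ge0.
- apply: filterS mfun0_ae => x /(_ I) zx _.
  by rewrite /= zx normr0 powR0.
Qed.

HB.instance Definition _ := @isFinLebesgue.Build _ _ R mu p%:E p1 mfun0
  mfun0_finite_norm.

(* The zero of L^p: the library puts no zmodType structure on LspaceType. *)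
Definition Lspace0 : LspaceType mu p1 := mfun0.

Lemma Lspace0P (u : LspaceType mu p1) :
  u = Lspace0 <-> (u : _ -> _) = cst 0%R %[ae mu].
Proof.
split=> [->//|u0].
have : (u : Mmu) = mfun0.
  rewrite -[LHS]reprK; apply/eqmodP/asboolP.
  by apply: filterS u0 => x.
rewrite /Lspace0; case: u u0 => f [[ff]] /= _ fE.
by subst f; rewrite (Prop_irrelevance ff mfun0_finite_norm).
Qed.
End Lspace0.
End nonlocal_space.
Arguments WKp {R d} K {p} p1.
Arguments Lspace0 {R d p} p1.

(* Main.v *)
Require Import Defs.
From mathcomp Require Import all_boot all_order all_algebra.
From mathcomp Require Import all_classical all_reals all_analysis.
From mathcomp Require Import measurable_realfun.
From mathcomp Require Import ring lra.
Import Order.TTheory GRing.Theory Num.Theory.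
Import numFieldNormedType.Exports.
Local Open Scope classical_set_scope.
Local Open Scope ring_scope.

Set Implicit Arguments.
Unset Strict Implicit.
Unset Printing Implicit Defensive.

(* Let u in L^p be nonzero and let r be such that K is not integrable on
   |z| >= r. A shift by a long vector moves most of the mass of the level set
   {|u| > t} to where |u| <= t/2, so |u(y + z) - u(y)| > t/2 on a set of y of
   measure at least c > 0 for all large |z|. Splitting the shift by n z into n
   shifts by z extends this, with t/2 and c divided by n, to all |z| >= r; this
   replaces the continuity of translations in L^p. By Tonelli, the double
   integral in [u]_{W^{K,p}} is then at least a positive multiple of the integral
   of K over |z| >= r, which is infinite. *)

(** * Displacement under measure preserving maps *)

Lemma measurable_norm_gt {disp : measure_display} {T : measurableType disp}
    {R : realType} (f : T -> R) (s : R) : measurable_fun setT f ->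
  measurable [set y | s < `|f y|].
Proof.
move=> mf; rewrite -[X in measurable X]setTI.
by apply: (measurable_fun_ltr (f := cst s)) => //; exact: measurableT_comp.
Qed.

Section measure_preserving.
Local Open Scope ereal_scope.
Context {disp : measure_display} {T : measurableType disp} {R : realType}.
Variables (mu : {measure set T -> \bar R}) (tau : T -> T) (v : T -> R).
Hypothesis mtau : measurable_fun setT tau.
Hypothesis mu_tau : forall A, measurable A -> mu (tau @^-1` A) = mu A.
Hypothesis mv : measurable_fun setT v.

Lemma measurable_iter n : measurable_fun setT (iter n tau).
Proof.
elim: n => [|n IH]; first exact: measurable_id.
by rewrite iterfS; exact: measurableT_comp.
Qed.

Lemma measurable_preimageT (f : T -> T) A :
  measurable_fun setT f -> measurable A -> measurable (f @^-1` A).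
Proof. by move=> mf mA; rewrite -[X in measurable X]setTI; exact: mf. Qed.

Lemma measure_preimage_iter n A :
  measurable A -> mu (iter n tau @^-1` A) = mu A.
Proof.
elim: n A => [|n IH] A mA //.
rewrite (_ : _ @^-1` A = iter n tau @^-1` (tau @^-1` A))//.
by rewrite IH ?mu_tau//; exact: measurable_preimageT.
Qed.

Lemma measurable_displacement (f : T -> T) (s : R) : measurable_fun setT f ->
  measurable [set y | (s < `|v (f y) - v y|)%R].
Proof.
move=> mf; apply: measurable_norm_gt; apply: measurable_funB => //.
exact: measurableT_comp.
Qed.

(** The displacement over [n + 1] steps is that over the first [n] plus that of the last step, so if
    it exceeds the sum of the two thresholds, one summand exceeds its own. The last step does so on
    the preimage of [D] under [iter n tau], which has the measure of [D]. *)
Lemma displacement_iter (s : R) n :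
  mu [set y | (n%:R * s < `|v (iter n tau y) - v y|)%R] <=
  n%:R%:E * mu [set y | (s < `|v (tau y) - v y|)%R].
Proof.
set D := [set y | (s < _)%R].
have mD : measurable D by exact: measurable_displacement.
elim: n => [|n IH].
  rewrite mul0e (_ : [set _ | _] = set0) ?measure0//.
  by rewrite -subset0 => y /=; rewrite subrr normr0 mul0r ltxx.
set Dn := [set y | (n%:R * s < _)%R] in IH.
have mDn : measurable Dn by exact/measurable_displacement/measurable_iter.
have mtD : measurable (iter n tau @^-1` D).
  exact/measurable_preimageT/mD/measurable_iter.
apply: (@le_trans _ _ (mu (Dn `|` iter n tau @^-1` D))).
  apply: le_measure; rewrite ?inE//.
  - exact/measurable_displacement/measurable_iter.
  - exact: measurableU.
  - move=> y /= hy.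
    rewrite /Dn /D /=; apply/orP; rewrite -[_ || _]negbK negb_or -!leNgt.
    apply/negP => /andP[h1 h2]; move: hy; apply/negP; rewrite -leNgt.
    rewrite -(subrKA (v (iter n tau y))) (le_trans (ler_normD _ _))//.
    by rewrite mulrSr mulrDl mul1r addrC lerD.
rewrite (le_trans (measureU2 _ _ _))//.
rewrite [X in _ + X]measure_preimage_iter// mulrSr EFinD ge0_muleDl ?lee_fin//.
by rewrite mul1e leeD2r.
Qed.

(** A point [y] with |v y| > t is either outside [C], or in [C] and sent outside it. In the second
    case either |v (tau y)| > s, so that [tau y] lies in the part of the lower level set outside
    [C], or |v| drops by more than [t - s]. *)
Lemma displacement_disjoint (C : set T) (s t : R) : (s < t)%R -> measurable C ->
  (forall y, C y -> ~ C (tau y)) ->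
  mu [set y | (t < `|v y|)%R] <=
  mu [set y | (t - s < `|v (tau y) - v y|)%R] +
  mu ([set y | (s < `|v y|)%R] `\` C) *+ 2.
Proof.
move=> st mC Ctau.
have mlevel (a : R) := measurable_norm_gt a mv.
set D := [set y | (t - s < _)%R]; set F := _ `\` C.
have mD : measurable D by exact: measurable_displacement.
have mF : measurable F by exact: measurableD.
have mtF : measurable (tau @^-1` F) by exact: measurable_preimageT.
apply: (@le_trans _ _ (mu (D `|` (F `|` tau @^-1` F)))).
  apply: le_measure; rewrite ?inE//; first by do 2 apply: measurableU => //.
  move=> y /= ty; have [Cy|Cy] := pselect (C y); last first.
    by right; left; split => //=; exact: lt_trans ty.
  have [sty|sty] := ltP s `|v (tau y)|%R.
    by right; right; split => //=; exact: Ctau.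
  left; rewrite /D /= distrC (lt_le_trans _ (lerB_dist _ _))//.
  by rewrite ltr_leB.
rewrite (le_trans (measureU2 _ _ _))//; first exact: measurableU.
rewrite leeD2l// (le_trans (measureU2 _ _ _))//.
by rewrite [X in _ + X]mu_tau// mule2n.
Qed.

End measure_preserving.

(** * Translations *)

Section translation.
Context {R : realType}.
Notation T := (measurableTypeR R).

Definition addt {d : nat} (z x : d.-tuple T) : d.-tuple T :=
  [tuple tnth x i + tnth z i | i < d].

Lemma addtC {d} (x y : d.-tuple T) : addt x y = addt y x.
Proof. by apply/eq_from_tnth => i; rewrite !tnth_mktuple addrC. Qed.

Lemma measurable_addt2 {d} :
  measurable_fun setT (fun w : d.-tuple T * d.-tuple T => addt w.1 w.2).
Proof.
apply/measurable_fun_tnthP => i.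
rewrite [X in measurable_fun _ X](_ : _ =
  fun w : d.-tuple T * d.-tuple T => (tnth w.2 i : R) + tnth w.1 i); last first.
  by apply/funext => w /=; rewrite tnth_mktuple.
apply: measurable_funD.
- exact: (measurableT_comp (measurable_tnth i) measurable_snd).
- exact: (measurableT_comp (measurable_tnth i) measurable_fst).
Qed.

Lemma measurable_addt {d} (z : d.-tuple T) : measurable_fun setT (addt z).
Proof. exact: (measurableT_comp measurable_addt2 (pair1_measurable z)). Qed.

Lemma tnth_iter_addt {d} (z y : d.-tuple T) n i :
  tnth (iter n (addt z) y) i = tnth y i + n%:R * tnth z i.
Proof.
elim: n => [|n IH]; first by rewrite mul0r addr0.
by rewrite iterS tnth_mktuple IH mulrSr mulrDl mul1r addrA.
Qed.

(** Lebesgue measure is determined by its values on half-open intervals, and a shift preserves their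
    length. *)
Lemma lebesgue_measure_addr (a : R) (A : set T) : measurable A ->
  lebesgue_measure ((fun x : T => (x + a : T)) @^-1` A) = lebesgue_measure A.
Proof.
move=> mA.
have ma : measurable_fun setT (fun x : T => (x + a : T)) by exact: measurable_funD.
apply/esym/(@lebesgue_measure_unique _ (pushforward lebesgue_measure
  (fun x : T => (x + a : T)))) => // _ [[b c]] _ <-.
rewrite /pushforward.
rewrite [X in _ = lebesgue_measure X](_ : _ = `]b - a, c - a]%classic); last first.
  by apply/seteqP; split=> x /=; rewrite !in_itv/= ltrBlDr lerBrDr.
rewrite !lebesgue_measure_itv/= !lte_fin ltrD2r.
by case: ifPn => // _; rewrite -!EFinD; congr EFin; ring.
Qed.

(** Induction on the dimension by slicing along the first coordinate: the induction hypothesis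
    shifts each slice by the tail of [z], and the one-dimensional case removes the shift by its
    head. *)
Lemma borel_lebesgue_addt d (z : d.-tuple T) (A : set (d.-tuple T)) :
  measurable A -> borel_lebesgue R d (addt z @^-1` A) = borel_lebesgue R d A.
Proof.
elim: d z A => [|d IH] z A mA.
  by rewrite (_ : addt z = id)//; apply/funext => x; rewrite (tuple0 x) [LHS]tuple0.
rewrite /= /cons_measure /pushforward /product_measure1.
set B := cons_pair @^-1` A.
have mB : measurable B.
  by rewrite -[X in measurable X]setTI; exact: measurable_cons_pair.
have mcB x : measurable (xsection B x) by exact: measurable_xsection.
set a := thead z; pose g (x : T) : T := x + a; set z' := [tuple of behead z].
transitivity (\int[lebesgue_measure]_x
    ((fun x => borel_lebesgue R d (xsection B x)) \o g) x)%E.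
  apply: eq_integral => x _ /=.
  have E y : addt z (cons_pair (x, y)) = cons_pair (x + a, addt z' y).
    apply/eq_from_tnth => i; rewrite tnth_mktuple.
    case: (unliftP ord0 i) => [j|] ->; rewrite ?tnthS ?tnth0//.
    by rewrite tnth_mktuple/= /z' [in LHS](tuple_eta z) tnthS.
  rewrite -[RHS](IH z')//; apply: congr1.
  by apply/seteqP; split=> y; rewrite /xsection/= !inE /B/= E.
have mg : measurable_fun setT g by exact: measurable_funD.
rewrite -(ge0_integral_pushforward mg _ (D := setT))//.
- apply: eq_measure_integral => //= C mC _; exact: lebesgue_measure_addr.
- exact: measurable_fun_xsection.
Qed.
End translation.

(** * Uniform lower bound for displacements under long translations *)

Section displacement.
Context {R : realType} {d : nat}.
Notation T := (measurableTypeR R).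
Variable lam : {measure set (d.-tuple T) -> \bar R}.
Hypothesis lam_addt : forall z A, measurable A -> lam (addt z @^-1` A) = lam A.

Definition cube (N : R) : set (d.-tuple T) :=
  [set x | forall i, (`|tnth x i| < N)%R].

Lemma measurable_cube N : measurable (cube N).
Proof.
rewrite (_ : cube N = \bigcap_(i in [set: 'I_d]) [set x | `|tnth x i : R| < N]).
  apply: fin_bigcap_measurable => // i _.
  rewrite -[X in measurable X]setTI.
  apply: (measurable_fun_ltr (g := cst N)) => //.
  by apply: measurableT_comp => //; exact: measurable_tnth.
by apply/seteqP; split=> [x xN i _|x xN i]; [exact: xN | exact: (xN i I)].
Qed.

Lemma bigcup_cube : \bigcup_n cube n%:R = setT.
Proof.
apply/seteqP; split=> // x _.
exists (Num.truncn (\sum_(i < d) `|tnth x i : R|)).+1 => // i.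
apply: le_lt_trans (truncnS_gt _).
by rewrite (bigD1 i)//= lerDl sumr_ge0.
Qed.

(** Continuity from above: the differences have finite measure and decrease to the empty set. *)
Lemma measure_setD_cube (F : set (d.-tuple T)) (e : R) :
  measurable F -> (lam F < +oo)%E -> 0 < e ->
  exists N : nat, (lam (F `\` cube N%:R) < e%:E)%E.
Proof.
move=> mF Foo e0.
have : (lam (F `\` cube n%:R) @[n --> \oo] --> lam (\bigcap_n (F `\` cube n%:R)))%E.
  apply: nonincreasing_cvg_mu => //.
  - apply: le_lt_trans Foo; apply: le_measure; rewrite ?inE//.
    by apply: measurableD => //; exact: measurable_cube.
  - by move=> n; apply: measurableD => //; exact: measurable_cube.
  - by apply: bigcapT_measurable => n; apply: measurableD => //; exact: measurable_cube.
  - move=> m n mn; apply/subsetPset => x [Fx xn]; split => // xm.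
    by apply: xn => i; rewrite (lt_le_trans (xm i))// ler_nat.
rewrite (_ : \bigcap_n _ = set0); last first.
  rewrite -subset0 => x xF.
  have : (\bigcup_n cube n%:R) x by rewrite bigcup_cube.
  by move=> [n _ xn]; have [] := xF n I.
rewrite measure0 => cvg0.
apply: contrapT => /forallNP Fe.
have : (e%:E <= 0)%E.
  by apply: (cvge_to_ge cvg0); near=> n; rewrite leNgt; apply/negP/Fe.
by rewrite lee_fin leNgt e0.
Unshelve. all: by end_near. Qed.

Variable v : d.-tuple T -> R.
Hypothesis mv : measurable_fun setT v.

(** Let [m] be the measure of {|v| > t}. A cube leaves out less than [m / 4] of {|v| > t / 2}, so
    [displacement_disjoint] for the [n]-fold shift gives displacement above [t / 2] on measure at
    least [m / 2]; [displacement_iter] returns to a single shift. Since [n] is chosen before [z],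
    the constants serve all [z]. *)
Lemma displacement_lower_bound (t r : R) : 0 < t -> 0 < r ->
  (0 < lam [set y | (t < `|v y|)%R])%E ->
  (forall s, 0 < s -> (lam [set y | (s < `|v y|)%R] < +oo)%E) ->
  exists s c : R, [/\ 0 < s, 0 < c & forall z : d.-tuple T,
    r ^+ 2 <= \sum_(i < d) (tnth z i : R) ^+ 2 ->
    (c%:E <= lam [set y | (s < `|v (addt z y) - v y|)%R])%E].
Proof.
move=> t0 r0 vt fin.
set m := fine (lam [set y | (t < `|v y|)%R]).
have Em : lam [set y | (t < `|v y|)%R] = m%:E.
  by rewrite fineK// ge0_fin_numE// fin.
have m0 : 0 < m by rewrite -lte_fin -Em.
have mF : measurable [set y | (t / 2 < `|v y|)%R] by exact: measurable_norm_gt.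
have t20 : 0 < t / 2 by rewrite divr_gt0.
have [N FN] := measure_setD_cube mF (fin _ t20) (e := m / 4) ltac:(lra).
(* For |z| >= r the shift by n z moves the cube of side 2N off itself. *)
set n := (Num.truncn (4 * N%:R ^+ 2 * d%:R / r ^+ 2)).+1.
(* An integer above the quotient itself, not above its square root, is enough because [n <= n ^+ 2]
   for [n >= 1]. *)
have nN : 4 * N%:R ^+ 2 * d%:R < n%:R ^+ 2 * r ^+ 2.
  have /= h := truncnS_gt (4 * N%:R ^+ 2 * d%:R / r ^+ 2).
  rewrite -ltr_pdivrMr ?exprn_gt0// (lt_le_trans h)// -/n.
  by rewrite ler_eXnr// ler1n.
have n0 : 0 < n%:R :> R by rewrite ltr0n.
exists (t / 2 / n%:R), (m / 2 / n%:R); split.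
- by rewrite divr_gt0.
- by rewrite !divr_gt0.
move=> z zr.
have mz := measurable_addt z.
have lz := lam_addt z.
(* If both points were in the cube, every coordinate of n z would be at most 2N in absolute value,
   so n^2 r^2 <= n^2 |z|^2 <= 4 N^2 d, against [nN]. *)
have off y : cube N%:R y -> ~ cube N%:R (iter n (addt z) y).
  move=> yN yzN; move: nN; apply/negP; rewrite -leNgt.
  rewrite (le_trans (ler_wpM2l _ zr)) ?exprn_ge0//.
  rewrite mulr_sumr -[d in leRHS]card_ord -sumr_const mulr_sumr.
  apply: ler_sum => i _; rewrite mulr1 -exprMn.
  rewrite (_ : 4 * N%:R ^+ 2 = (2 * N%:R) ^+ 2 :> R); last by ring.
  rewrite -[leLHS]real_normK ?num_real// lerXn2r ?nnegrE ?mulr_ge0//.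
  have := yN i; have := yzN i; rewrite tnth_iter_addt => h1 h2.
  rewrite (_ : n%:R * tnth z i =
    (tnth y i + n%:R * tnth z i) - (tnth y i : R)); last by ring.
  by rewrite (le_trans (ler_normB _ _))// mulrDl mul1r lerD// ltW.
have mit : measurable_fun setT (iter n (addt z)) by exact: measurable_iter.
have lit A : measurable A -> lam (iter n (addt z) @^-1` A) = lam A.
  by move=> mA; exact: (measure_preimage_iter mz lz).
set s := t / 2 / n%:R; set Y := lam _.
have XY : (lam [set y | (n%:R * s < `|v (iter n (addt z) y) - v y|)%R] <= n%:R%:E * Y)%E.
  exact: (displacement_iter mz lz mv s n).
have mXF : (m%:E <= lam [set y | (n%:R * s < `|v (iter n (addt z) y) - v y|)%R] +
    lam ([set y | (t / 2 < `|v y|)%R] `\` cube N%:R) *+ 2)%E.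
  rewrite -Em (_ : n%:R * s = t - t / 2); last first.
    by rewrite /s; field; rewrite gt_eqF.
  have t2t : t / 2 < t by lra.
  exact: (displacement_disjoint mit lit mv t2t (measurable_cube N%:R) off).
have : (m%:E <= n%:R%:E * Y + (m / 2)%R%:E)%E.
  apply: (le_trans mXF); rewrite leeD// mule2n.
  by rewrite (_ : m / 2 = m / 4 + m / 4) ?EFinD ?leeD ?ltW//; lra.
rewrite -leeBlDr// -EFinB (_ : m - m / 2 = n%:R * (m / 2 / n%:R)); last first.
  by field; rewrite gt_eqF.
by rewrite EFinM lee_pmul2l// lte_fin.
Qed.

End displacement.

(** * Completion of a measure *)

Section completion.
Local Open Scope ereal_scope.
Context {disp : measure_display} {T : measurableType disp} {R : realType}.
Variable mu : {sigma_finite_measure set T -> \bar R}.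
Local Notation cT := (caratheodory_type mu^*%mu).
Local Notation cmu := (@completed_measure_extension _ _ _ mu).

Lemma measurable_completion (A : set T) :
  measurable A -> measurable (A : set cT).
Proof. exact: caratheodory_measurable_mu_ext. Qed.

Lemma completionE (A : set T) : measurable A -> cmu A = mu A.
Proof. by move=> mA; rewrite /completed_measure_extension measurable_mu_extE. Qed.

Lemma mu_ext_le (A B : set T) :
  A `<=` B -> measurable B -> (mu^* A)%mu <= mu B.
Proof. by move=> AB mB; rewrite -completionE//; exact: le_mu_ext. Qed.

(** The identity from the completed space to the original one is measurable and pushes [cmu] forward
    to [mu]. *)
Lemma ge0_integral_completion (f : T -> \bar R) (D : set T) : measurable D ->
  measurable_fun D f -> (forall x, D x -> 0 <= f x) ->
  \int[cmu]_(x in D) f x = \int[mu]_(x in D) f x.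
Proof.
move=> mD mf f0.
have mid : measurable_fun setT (id : cT -> T).
  by move=> _ B mB; rewrite setTI; exact: measurable_completion.
rewrite -[LHS](ge0_integral_pushforward mid) => //.
- apply: eq_measure_integral => A mA _; exact: completionE.
- by move=> x; rewrite inE; exact: f0.
Qed.

(** Intersect countable covers whose measures exceed the outer measure by at most 1/(n+1). If the
    outer measure is infinite, the whole space serves. *)
Lemma measurable_hull (E : set T) : exists2 F,
  measurable F & E `<=` F /\ mu F = (mu^* E)%mu.
Proof.
have [Eoo|Eoo] := eqVneq (mu^* E)%mu +oo.
  exists setT => //; split=> //; rewrite Eoo; apply/eqP.
  by rewrite -leye_eq -Eoo mu_ext_le.
have Efin : (mu^* E)%mu \is a fin_num.
  by rewrite ge0_fin_numE ?mu_ext_ge0// ltey.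
have H n : exists F, [/\ measurable F, E `<=` F &
    mu F <= (mu^* E)%mu + (n.+1%:R^-1)%:E].
  have n0 : (0 < n.+1%:R^-1 :> R)%R by rewrite invr_gt0.
  have [_ [A [mA EA] <-] lt] := lb_ereal_inf_adherent n0 Efin.
  exists (\bigcup_k A k); split=> //; first exact: bigcup_measurable.
  apply: le_trans (ltW lt).
  by apply: measure_sigma_subadditive => //; exact: bigcup_measurable.
have [F HF] := choice H.
have mF : measurable (\bigcap_n F n).
  by apply: bigcapT_measurable => n; have [] := HF n.
have EF : E `<=` \bigcap_n F n by move=> x Ex n _; have [_ + _] := HF n; exact.
exists (\bigcap_n F n) => //; split=> //; apply/eqP; rewrite eq_le; apply/andP; split.
  apply/lee_addgt0Pr => _/posnumP[e]; near \oo => n.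
  have [mFn _ le] := HF n.
  apply: (@le_trans _ _ (mu (F n))).
    by apply: le_measure; rewrite ?inE//; exact: bigcap_inf.
  rewrite (le_trans le)// leeD// lee_fin ltW//.
  by near: n; apply: near_infty_natSinv_lt.
exact: mu_ext_le.
Unshelve. all: by end_near. Qed.

(* A completed-measurable set agrees with its hull off a null set; the general
   case follows by cutting along a sigma-finite exhaustion. *)
Lemma completion_ae_measurable (E : set T) : measurable (E : set cT) ->
  exists F N, [/\ measurable F, measurable N, mu N = 0 & E `\` N = F `\` N].
Proof.
move=> mE.
have [S ST HS] := sigma_finiteT mu.
have H n : exists FN : set T * set T, [/\ measurable FN.1, measurable FN.2,
    mu FN.2 = 0 & (E `&` S n) `\` FN.2 = FN.1 `\` FN.2].
  have [mS Soo] := HS n.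
  have mES : measurable (E `&` S n : set cT).
    by apply: measurableI => //; exact: measurable_completion.
  (* [F] is a hull of the piece of finite measure, and [N] a hull of what [F] has in excess. *)
  have [F mF [EF muF]] := measurable_hull (E `&` S n).
  have [N mN [FN muN]] := measurable_hull (F `\` (E `&` S n)).
  exists (F, N); split => //=.
    rewrite muN.
    have Foo : mu F < +oo.
      by rewrite muF (le_lt_trans _ Soo)// mu_ext_le.
    have cF : measurable (F : set cT) by exact: measurable_completion.
    (* The measurability of [E] in the completion enters here: it allows subtraction, and the two
       terms are equal and finite, so the excess is null. *)
    have : cmu (F `\` (E `&` S n)) = cmu F - cmu (E `&` S n).
      rewrite measureD//; first by rewrite setIidr.
      by rewrite [X in X < _]completionE.
    rewrite /completed_measure_extension => ->.
    rewrite measurable_mu_extE// [X in X - _]muF subee//.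
    by rewrite ge0_fin_numE ?mu_ext_ge0// -muF.
  apply/seteqP; split=> x [xE xN]; split => //; first exact: EF.
  by apply: contrapT => nx; apply: xN; exact: FN.
have [FN HFN] := choice H.
exists (\bigcup_n (FN n).1), (\bigcup_n (FN n).2); split.
- by apply: bigcupT_measurable => n; have [] := HFN n.
- by apply: bigcupT_measurable => n; have [] := HFN n.
- apply/negligibleP.
    by apply: bigcupT_measurable => n; have [] := HFN n.
  apply: negligible_bigcup => n; apply/negligibleP; by have [] := HFN n.
- apply/seteqP; split=> x [xE xN]; split => //.
  + have : (\bigcup_n S n) x by rewrite -ST.
    move=> [n _ Sx]; exists n => //.
    have [_ _ _ /seteqP[+ _]] := HFN n; move=> /(_ x) [|//].
    by split => // ?; apply: xN; exists n.
  + have [n _ Fx] := xE.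
    have [_ _ _ /seteqP[_ +]] := HFN n; move=> /(_ x) [|[]//].
    by split => // ?; apply: xN; exists n.
Qed.

(** Superlevel sets at rational levels determine measurability, and there are countably many of
    them: correct each one off a null set and discard the union of these null sets. *)
Lemma completion_fun_ae_measurable (f : T -> \bar R) :
  measurable_fun [set: cT] f ->
  exists N, [/\ measurable N, mu N = 0 & measurable_fun (~` N) (f : T -> \bar R)].
Proof.
move=> mf.
(* An enumeration of the rationals; the default 0 at indices that decode to nothing only repeats a
   level. *)
pose q n : rat := odflt 0%R (unpickle n).
have H n : exists FN : set T * set T, [/\ measurable FN.1,
    measurable FN.2, mu FN.2 = 0 &
    [set x | (ratr (q n))%:E < f x] `\` FN.2 = FN.1 `\` FN.2].
  have [|F [N HF]] := @completion_ae_measurable [set x | (ratr (q n))%:E < f x].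
    by rewrite -[X in measurable X]setTI; exact: emeasurable_fun_o_infty.
  by exists (F, N).
have [FN HFN] := choice H.
pose N := \bigcup_n (FN n).2.
have mN : measurable N by apply: bigcupT_measurable => n; have [] := HFN n.
exists N; split => //.
  apply/negligibleP => //.
  by apply: negligible_bigcup => n; apply/negligibleP; have [] := HFN n.
move=> mNc; apply: (measurability _ (ErealGenOInfty.measurableE R)) => // _ [_ [r ->] <-].
(* Off [N], the set {f > r} is the union of the sets {f > q} over rationals q >= r, by density. *)
rewrite (_ : _ `&` _ = \bigcup_(n in [set n | (r <= ratr (q n))%R]) ((FN n).1 `\` N)).
  apply: bigcup_measurable => n _; apply: measurableD => //.
  by have [] := HFN n.
have inFN n x : ~ N x -> (FN n).1 x <-> (ratr (q n))%:E < f x.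
  move=> Nx; have nx : ~ (FN n).2 x by move=> ?; apply: Nx; exists n.
  have [_ _ _ /seteqP[h1 h2]] := HFN n.
  by split=> h; [have [] := h2 x (conj h nx) | have [] := h1 x (conj h nx)].
apply/seteqP; split=> x /=.
  rewrite in_itv/= andbT => -[Nx rf].
  have [p [rp pf]] : exists p : rat, (r < ratr p)%R /\ (ratr p)%:E < f x.
    case: (f x) rf => [y| |]//.
      rewrite lte_fin => /rat_in_itvoo[p]; rewrite in_itv/= => /andP[? ?].
      by exists p.
    have /rat_in_itvoo[p] : (r < r + 1)%R by rewrite ltrDl.
    by rewrite in_itv/= => /andP[? _] _; exists p; rewrite ltry.
  have qp : q (pickle p) = p by rewrite /q pickleK.
  exists (pickle p); first by rewrite /= qp ltW.
  by split => //; apply/inFN => //; rewrite qp.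
move=> [n /= rq [Fx Nx]]; split=> //; rewrite in_itv/= andbT.
by apply: le_lt_trans (iffLR (inFN n x Nx) Fx); rewrite lee_fin.
Qed.
End completion.

(** * Divergence of the double integral *)

Lemma measurable_sum_sqr_ge {R : realType} {d : nat} (a : R) :
  measurable [set z : d.-tuple (measurableTypeR R) |
    a <= \sum_(i < d) (tnth z i : R) ^+ 2].
Proof.
rewrite -[X in measurable X]setTI; apply: (measurable_fun_ler (f := cst a)) => //.
by apply: measurable_sum => i; apply: measurable_funX; exact: measurable_tnth.
Qed.

Section divergence.
Context {R : realType} {d : nat}.
Notation T := (measurableTypeR R).
Variable lam : {sigma_finite_measure set (d.-tuple T) -> \bar R}.
Hypothesis lam_addt : forall z A, measurable A -> lam (addt z @^-1` A) = lam A.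
Variables (v : d.-tuple T -> R) (k : d.-tuple T -> \bar R) (N : set (d.-tuple T)).
Hypotheses (mv : measurable_fun setT v) (mk : measurable_fun setT k)
  (k0 : forall z, (0 <= k z)%E) (mN : measurable N) (N0 : lam N = 0%E).

(** In a pair, [w.1] stands for y and [w.2] for x. Off the null set [N], the Borel function [v] will
    agree with the given Lebesgue measurable one. *)
Definition gap_set (s : R) : set (d.-tuple T * d.-tuple T) :=
  [set w | [/\ ~ N w.1, ~ N w.2 & s < `|v w.2 - v w.1|]].

(** Multiplied by s^p, this will be a Borel minorant of the integrand of the seminorm. *)
Definition gap_kernel (s : R) (w : d.-tuple T * d.-tuple T) : \bar R :=
  (k (@subRd R d w.2 w.1) * (\1_(gap_set s) w)%:E)%E.

Lemma measurable_subRd : measurable_fun setT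
  (fun w : d.-tuple T * d.-tuple T => (@subRd R d w.2 w.1 : d.-tuple T)).
Proof.
apply/measurable_fun_tnthP => i.
rewrite [X in measurable_fun _ X](_ : _ =
  fun w : d.-tuple T * d.-tuple T => (tnth w.2 i : R) - tnth w.1 i); last first.
  by apply/funext => w /=; rewrite tnth_mktuple.
apply: measurable_funB.
- exact: (measurableT_comp (measurable_tnth i) measurable_snd).
- exact: (measurableT_comp (measurable_tnth i) measurable_fst).
Qed.

Lemma measurable_gap_set s : measurable (gap_set s).
Proof.
rewrite (_ : gap_set s = (fst @^-1` (~` N)) `&` ((snd @^-1` (~` N)) `&`
    [set w | s < `|v w.2 - v w.1|])); last first.
  by apply/seteqP; split=> w /=; [move=> [? ? ?] | move=> [? [? ?]]].
have mNC := measurableC mN.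
apply: measurableI.
  by rewrite -[X in measurable X]setTI; exact: measurable_fst.
apply: measurableI.
  by rewrite -[X in measurable X]setTI; exact: measurable_snd.
apply: measurable_norm_gt; apply: measurable_funB.
- exact: measurableT_comp.
- exact: measurableT_comp.
Qed.

Lemma measurable_gap_kernel s : measurable_fun setT (gap_kernel s).
Proof.
apply: emeasurable_funM.
- exact: (measurableT_comp mk measurable_subRd).
- apply/measurable_EFinP; by apply: measurable_indic; exact: measurable_gap_set.
Qed.

Lemma gap_kernel_ge0 s w : (0 <= gap_kernel s w)%E.
Proof. by rewrite mule_ge0// lee_fin. Qed.

(** Substitute x = y + z and exchange the integrals by Tonelli: the inner integral becomes [k z]
    times the measure of the gap in y, which is at least [c] once |z| >= r. *)
Lemma gap_kernel_divergence (t r : R) : 0 < t -> 0 < r ->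
  (0 < lam [set y | (t < `|v y|)%R])%E ->
  (forall s, 0 < s -> (lam [set y | (s < `|v y|)%R] < +oo)%E) ->
  (\int[lam]_(z in [set z | (r ^+ 2 <= \sum_(i < d) (tnth z i : R) ^+ 2)%R]) k z
    = +oo)%E ->
  exists2 s, 0 < s & (\int[lam]_y \int[lam]_x gap_kernel s (y, x) = +oo)%E.
Proof.
move=> t0 r0 vt fin kint.
have [s [c [s0 c0 cs]]] := displacement_lower_bound lam_addt mv t0 r0 vt fin.
exists s => //.
(* The gap kernel in the variables (y, z), where x = y + z. *)
pose G (w : d.-tuple T * d.-tuple T) :=
  (k w.2 * (\1_(gap_set s) (w.1, addt w.1 w.2))%:E)%E.
have mpair : measurable_fun setT
    (fun w : d.-tuple T * d.-tuple T => (w.1, addt w.1 w.2)).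
  by apply/measurable_fun_pairP; split; [exact: measurable_fst | exact: measurable_addt2].
have mGap : measurable [set w | gap_set s (w.1, addt w.1 w.2)].
  rewrite -[X in measurable X]setTI; by apply: mpair => //; exact: measurable_gap_set.
have mG : measurable_fun setT G.
  apply: emeasurable_funM; first exact: measurableT_comp.
  apply/measurable_EFinP; apply: (measurableT_comp _ mpair).
  by apply: measurable_indic; exact: measurable_gap_set.
have G0 w : (0 <= G w)%E by rewrite mule_ge0// lee_fin.
have -> : (\int[lam]_y \int[lam]_x gap_kernel s (y, x) =
           \int[lam]_y \int[lam]_z G (y, z))%E.
  apply: eq_integral => y _.
  transitivity (\int[lam]_z ((fun x => gap_kernel s (y, x)) \o addt y) z)%E.
    rewrite -(ge0_integral_pushforward (measurable_addt y) _ (D := setT))//.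
      - apply: eq_measure_integral => [|? A mA _]; first exact: measurable_addt.
      exact/esym/lam_addt.
    - exact: (measurableT_comp (measurable_gap_kernel s) (pair1_measurable y)).
    - by move=> x _; exact: gap_kernel_ge0.
  apply: eq_integral => z _; rewrite /gap_kernel /G /=; congr (k _ * _)%E.
  by apply/eq_from_tnth => i; rewrite !tnth_mktuple addrK.
rewrite (fubini_tonelli G)//.
have slice z : (\int[lam]_y G (y, z) = k z * lam [set y | gap_set s (y, addt y z)])%E.
  have mS : measurable [set y | gap_set s (y, addt y z)].
    have := measurable_ysection z mGap.
    by congr measurable; apply/seteqP; split => y; rewrite /ysection/= inE.
  set S := [set y | _] in mS *.
  transitivity (\int[lam]_y (k z * (\1_S y)%:E))%E; first exact: eq_integral.
  rewrite (ge0_integralZl lam measurableT (f := fun y => (\1_S y)%:E))//.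
    by rewrite integral_indic// setIT.
  by apply/measurable_EFinP; exact: measurable_indic.
under eq_integral do rewrite slice.
apply/eqP; rewrite -leye_eq.
set Z := [set z | _] in kint.
have mZ : measurable Z by exact: measurable_sum_sqr_ge.
(* Compared with the displacement set, the gap loses only points of [N] and of its translate, both
   null. *)
have gap_ge z : Z z -> (c%:E <= lam [set y | gap_set s (y, addt y z)])%E.
  move=> zr; apply: (le_trans (cs z zr)).
  have mS : measurable [set y | gap_set s (y, addt y z)].
    have := measurable_ysection z mGap.
    by congr measurable; apply/seteqP; split => y; rewrite /ysection/= inE.
  have mzN : measurable (addt z @^-1` N).
    by apply: measurable_preimageT => //; exact: measurable_addt.
  apply: (@le_trans _ _ (lam ([set y | gap_set s (y, addt y z)] `|`
      (N `|` addt z @^-1` N)))).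
    apply: le_measure; rewrite ?inE//.
    - by apply: measurable_displacement => //; exact: measurable_addt.
    - by do 2 apply: measurableU => //.
    - move=> y /= sy; have [Ny|Ny] := pselect (N y); first by right; left.
      have [Nzy|Nzy] := pselect (N (addt z y)); first by right; right.
      by left; rewrite /gap_set/= addtC.
  rewrite (le_trans (measureU2 _ _ _))//; first exact: measurableU.
  rewrite -[leRHS]adde0 leeD2l// (le_trans (measureU2 _ _ _))//.
  by rewrite [X in _ + X]lam_addt// N0 adde0 [leLHS]N0.
(* By [slice] this function is a marginal integral of [G], so its measurability comes from
   Tonelli. *)
have mkl : measurable_fun setT
    (fun z => k z * lam [set y | gap_set s (y, addt y z)])%E.
  under eq_fun do rewrite -slice.
  exact: measurable_fun_fubini_tonelli_G.
apply: (@le_trans _ _ (\int[lam]_(z in Z) (c%:E * k z))%E).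
  rewrite ge0_integralZl_EFin//; last exact: ltW.
    by rewrite kint gt0_muley ?lte_fin// lexx.
  exact: measurable_funTS.
apply: (@le_trans _ _ (\int[lam]_(z in Z)
    (k z * lam [set y | gap_set s (y, addt y z)]))%E).
  apply: ge0_le_integral => //.
  - by move=> z _; rewrite mule_ge0// lee_fin ltW.
  - by apply: emeasurable_funM => //; exact: measurable_funTS.
  - exact: measurable_funTS.
  - by move=> z Zz; rewrite muleC lee_wpmul2l// gap_ge.
apply: ge0_subset_integral => //.
by move=> z _; rewrite mule_ge0.
Qed.
End divergence.

(** * Integrals of nonnegative functions without measurability *)

Section integral_nonneg_nonmeasurable.
Local Open Scope ereal_scope.
Context {disp : measure_display} {T : measurableType disp} {R : realType}.
Variable mu : {measure set T -> \bar R}.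

(* Unlike [ge0_le_integral], no measurability: the integral of a nonnegative
   function is a supremum over the simple functions below it. *)
Lemma ge0_le_integralT (f g : T -> \bar R) : (forall x, 0 <= f x) ->
  (forall x, f x <= g x) -> \int[mu]_x f x <= \int[mu]_x g x.
Proof.
move=> f0 fg; rewrite !ge0_integralTE//; last first.
  by move=> x; exact: le_trans (f0 x) (fg x).
apply: le_ereal_sup => _ /= [h hf <-]; exists h => // x.
exact: le_trans (hf x) (fg x).
Qed.

(** The function lies below the one equal to [+oo] on a null set and 0 elsewhere, whose integral is
    [+oo * 0 = 0]. *)
Lemma ge0_ae0_integral (f : T -> \bar R) : (forall x, 0 <= f x) ->
  {ae mu, forall x, f x = 0} -> \int[mu]_x f x = 0.
Proof.
move=> f0 [N [mN N0 fN]]; apply/eqP; rewrite eq_le integral_ge0// andbT.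
apply: (@le_trans _ _ (\int[mu]_x ((cst +oo) \_ N) x)).
  apply: ge0_le_integralT => // x; rewrite patchE.
  case: ifPn => [_|]; first by rewrite leey.
  rewrite notin_setE => Nx; rewrite le_eqVlt; apply/orP; left; apply/eqP.
  by apply: contrapT => fx; apply: Nx; exact: fN.
by rewrite -integral_mkcond integral_cst// N0 mule0.
Qed.

End integral_nonneg_nonmeasurable.

(** * Passage from Borel to Lebesgue measurable functions *)

Section completed_divergence.
Local Open Scope ereal_scope.
Context {R : realType} {d : nat}.
Notation T := (measurableTypeR R).
Variable mu : {sigma_finite_measure set (d.-tuple T) -> \bar R}.
Hypothesis mu_addt : forall z A, measurable A -> mu (addt z @^-1` A) = mu A.
Local Notation cT := (caratheodory_type mu^*%mu).
Local Notation cmu := (@completed_measure_extension _ _ _ mu).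

Variables (f : d.-tuple T -> R) (K : d.-tuple T -> \bar R) (p r : R).
Hypotheses (mf : measurable_fun [set: cT] (f : cT -> R))
  (mK : measurable_fun [set: cT] (K : cT -> \bar R))
  (K0 : forall z, 0 <= K z) (p0 : (0 < p)%R) (r0 : (0 < r)%R).

(** [f] and [K] are replaced by Borel functions equal to them almost everywhere, for which Tonelli
    applies. The resulting divergent integral is carried back through a pointwise minorant, so the
    original double integral is only compared by monotonicity. *)
Lemma completed_divergence :
  \int[cmu]_x `|(f x)%:E| `^ p < +oo ->
  ~ {ae cmu, forall x, f x = 0%R} ->
  \int[cmu]_(z in [set z | (r ^+ 2 <= \sum_(i < d) (tnth z i : R) ^+ 2)%R]) K z
    = +oo ->
  \int[cmu]_y \int[cmu]_x ((`|f x - f y| `^ p)%R%:E * K (@subRd R d x y)) = +oo.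
Proof.
move=> fp fn0 Koo.
have mEf0 : measurable_fun [set: cT] (EFin \o (f : cT -> R)).
  exact: (iffRL (measurable_EFinP _ _) mf).
have mEf : measurable_fun [set: cT] (fun x : cT => `|(f x)%:E|).
  exact: (measurableT_comp (@abse_measurable R setT) mEf0).
have [N1 [mN1 N10 mf1]] := completion_fun_ae_measurable mEf0.
have [N2 [mN2 N20 mK2]] := completion_fun_ae_measurable mK.
have mN1C := measurableC mN1; have mN2C := measurableC mN2.
(* Both restrictions take the value 0 on the discarded null set; hence [k] lies below [K]
   everywhere, not just almost everywhere. *)
pose v : d.-tuple T -> R := f \_ (~` N1).
pose k : d.-tuple T -> \bar R := K \_ (~` N2).
have mv : measurable_fun setT v.
  by apply/(measurable_restrictT _ mN1C); apply/measurable_EFinP.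
have mk : measurable_fun setT k by exact/(measurable_restrictT _ mN2C).
have k0 z : 0 <= k z by apply: erestrict_ge0.
have vf x : ~ N1 x -> v x = f x by move=> Nx; rewrite /v patchE mem_set.
have kK z : k z <= K z.
  by rewrite /k patchE; case: ifPn.
have mlevel (s : R) := measurable_norm_gt s mv.
have cN1 : measurable (N1 : set cT) by exact: measurable_completion.
have cN2 : measurable (N2 : set cT) by exact: measurable_completion.
(* Chebyshev's inequality for [f]: where |v| > s > 0, the value is that of [f]. *)
have vfin (s : R) : (0 < s)%R -> mu [set y | (s < `|v y|)%R] < +oo.
  move=> s0.
  have mfs : measurable ([set y | s%:E <= `|(f y)%:E|] : set cT).
    have := emeasurable_fun_c_infty measurableT mEf s%:E.
    by rewrite setTI.
  rewrite -completionE//.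
  apply: (@le_lt_trans _ _ (cmu [set y | s%:E <= `|(f y)%:E|])).
    apply: le_measure; rewrite ?inE//; first exact: measurable_completion.
    move=> y /=; rewrite /v patchE; case: ifPn => _ sy; last first.
      by move: sy; rewrite /point/= normr0 ltNge ltW.
    by rewrite lee_fin ltW.
  have := @le_integral_comp_abse _ cT R cmu setT measurableT (EFin \o f) s
    (fun x => x `^ p) (measurable_poweR p).
  rewrite setTI => /(_ _ _ _ s0) le.
  have {}le : (s `^ p)%:E * cmu [set y | s%:E <= `|(f y)%:E|] <=
      \int[cmu]_x `|(f x)%:E| `^ p.
    apply: le.
    - by move=> ? _; exact: poweR_ge0.
    - move=> x y; rewrite !inE/= !in_itv/= !andbT => x0 y0 xy.
      by rewrite gt0_ler_poweR// ?in_itv/= ?leey ?andbT// ltW.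
    - exact: mEf0.
  have sp : (0 < s `^ p)%R by rewrite powR_gt0.
  rewrite -(@lte_pmul2l _ (s `^ p)%:E)// ?lte_fin//.
  by rewrite (le_lt_trans le)// gt0_muley ?lte_fin.
(* Otherwise {f <> 0} would be covered by [N1] and the null sets {|v| > 1/(n+1)}. *)
have [t [t0 vt]] : exists t : R, (0 < t)%R /\ 0 < mu [set y | (t < `|v y|)%R].
  apply: contrapT => /forallNP nt; apply: fn0.
  have vn n : mu [set y | (n.+1%:R^-1 < `|v y|)%R] = 0.
    apply/eqP; rewrite eq_le measure_ge0 andbT leNgt; apply/negP => h.
    by apply: (nt n.+1%:R^-1%R); split => //; rewrite invr_gt0.
  have : cmu.-negligible (N1 `|` \bigcup_n [set y | (n.+1%:R^-1 < `|v y|)%R]).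
    apply: negligibleU.
      by apply/negligibleP => //; exact: etrans (completionE mu mN1) N10.
    apply: negligible_bigcup => n; apply/negligibleP.
      exact: measurable_completion.
    exact: etrans (completionE mu (mlevel _)) (vn n).
  apply: negligibleS => x /= fx.
  have [Nx|Nx] := pselect (N1 x); first by left.
  right; exists (Num.truncn (`|v x|^-1)%R) => //=.
  have vx : (0 < `|v x|)%R by rewrite normr_gt0 vf//; apply/eqP.
  by rewrite -[ltRHS]invrK ltf_pV2 ?posrE ?invr_gt0// truncnS_gt.
set Z := [set z | _] in Koo.
have mZ : measurable Z by exact: measurable_sum_sqr_ge.
have cZ : measurable (Z : set cT) by exact: measurable_completion.
have cN2C : measurable (~` N2 : set cT) by exact: measurableC.
(* [k] and [K] differ only on the null set [N2], and [k] is Borel, so its integral is the same for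
   [mu] and its completion. *)
have koo : \int[mu]_(z in Z) k z = +oo.
  rewrite -ge0_integral_completion//; last exact: measurable_funTS.
  rewrite -Koo; apply: ge0_ae_eq_integral => //.
  - apply: measurable_funTS; apply/(measurable_restrictT _ cN2C).
    exact: measurable_funTS.
  - exact: measurable_funTS.
  - exists N2; split => [//||z /=]; first exact: etrans (completionE mu mN2) N20.
    move/not_implyP => [_ kz]; apply: contrapT => Nz; apply: kz.
    by rewrite /k patchE mem_set.
have [s s0 soo] := gap_kernel_divergence mu_addt mv mk k0 mN1 N10 t0 r0 vt vfin koo.
have sp : (0 < s `^ p)%R by rewrite powR_gt0.
pose h w := (s `^ p)%:E * gap_kernel v k N1 s w.
have mgk := measurable_gap_kernel mv mk mN1 s.
have mh : measurable_fun setT h by exact: measurable_funeM.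
have h0 w : 0 <= h w by rewrite mule_ge0 ?gap_kernel_ge0// lee_fin ltW.
have mslice (g : d.-tuple T * d.-tuple T -> \bar R) y :
    measurable_fun setT g -> measurable_fun setT (fun x => g (y, x)).
  by move=> mg; exact: (measurableT_comp mg (pair1_measurable y)).
have hoo : \int[mu]_y \int[mu]_x h (y, x) = +oo.
  transitivity (\int[mu]_y ((s `^ p)%:E * \int[mu]_x gap_kernel v k N1 s (y, x))).
    apply: eq_integral => y _; rewrite ge0_integralZl_EFin ?ltW//.
    - by move=> x _; exact: gap_kernel_ge0.
    - exact: mslice.
  rewrite ge0_integralZl_EFin ?ltW//.
  - by rewrite soo gt0_muley ?lte_fin.
  - by move=> y _; apply: integral_ge0 => x _; exact: gap_kernel_ge0.
  - exact: (measurable_fun_fubini_tonelli_F _ mgk (gap_kernel_ge0 v N1 k0 s)).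
have choo : \int[cmu]_y \int[cmu]_x h (y, x) = +oo.
  rewrite -hoo -ge0_integral_completion//; last 2 first.
  - exact: (measurable_fun_fubini_tonelli_F _ mh h0).
  - by move=> y _; apply: integral_ge0 => x _; exact: h0.
  apply: eq_integral => y _; apply: ge0_integral_completion => //.
  exact: mslice.
apply/eqP; rewrite -leye_eq -choo.
(* Pointwise comparison: on the gap set both points avoid [N1], so [v] equals [f] there and |f x - f
   y|^p >= s^p; elsewhere [h] vanishes. *)
apply: ge0_le_integralT => [y|y]; first by apply: integral_ge0 => x _; exact: h0.
apply: ge0_le_integralT => [x|x]; first exact: h0.
rewrite /h /gap_kernel indicE.
have [|_] := boolP (_ \in _); last by rewrite !mule0 mule_ge0// lee_fin powR_ge0.
rewrite inE /gap_set/= => -[Ny Nx sxy]; rewrite mule1.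
rewrite lee_pmul ?lee_fin ?powR_ge0//.
rewrite -vf// -(vf y)//.
by apply: ge0_ler_powR; rewrite ?nnegrE//; exact: ltW.
Qed.

End completed_divergence.

(** * Triviality of the space *)

Lemma enorm_ge (R : realType) (d : nat) (r : R) (z : Rd R d) : 0 < r ->
  (r <= enorm z) = (r ^+ 2 <= \sum_(i < d) (tnth z i : R) ^+ 2).
Proof.
move=> r0; rewrite /enorm -[r in LHS]gtr0_norm// -sqrtr_sqr ler_sqrt//.
by apply: sumr_ge0 => i _; exact: sqr_ge0.
Qed.

(** For almost every y the integrand vanishes for almost every x. The almost everywhere form is
    needed because the representative of the zero class need not vanish everywhere. *)
Lemma seminormK0 (R : realType) (d : nat) (K : Rd R d -> \bar R) (p : R)
    (u : Rd R d -> R) : (forall x, (0 <= K x)%E) -> 0 < p ->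
  {ae lebesgue_Rd R d, forall x, u x = 0} -> seminormK K p u = 0%E.
Proof.
move=> K0 p0 u0; rewrite /seminormK ge0_ae0_integral ?poweR0r ?invr_neq0 ?gt_eqF//.
  move=> y; apply: integral_ge0 => x _.
  by rewrite mule_ge0// lee_fin powR_ge0.
apply: filterS (u0) => y uy; apply: ge0_ae0_integral.
  by move=> x; rewrite mule_ge0// lee_fin powR_ge0.
apply: filterS u0 => x ux.
by rewrite ux uy subrr normr0 powR0 ?gt_eqF// mul0e.
Qed.

Theorem proposition3p3 (R : realType) (d : nat) (hd : (1 <= d)%N)
    (K : Rd R d -> \bar R) (hK : is_kernel K)
    (hfail : ~ (forall r : R, 0 < r ->
        (lebesgue_Rd R d).-integrable (~` Rd_ball d r) K)) :
  forall (p : R) (p1 : (1 <= p%:E)%E), WKp K p1 = [set Lspace0 p1].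
Proof.
move=> p p1; have [mK K0 _] := hK.
have p0 : 0 < p by rewrite (lt_le_trans ltr01).
apply/seteqP; split => [u /= uK|_ ->]; last first.
  rewrite /WKp/= seminormK0//.
  have /Lspace0P : Lspace0 p1 = Lspace0 p1 :> LspaceType (lebesgue_Rd R d) p1 by [].
  by apply: filterS => x /(_ I).
apply/Lspace0P; apply: contrapT => u0.
have /existsNP[r /not_implyP[r0 rK]] := hfail.
have mu_ := measurable_funPT
  (repr (u : {mfun_ lebesgue_Rd R d, Rd R d >-> measurableTypeR R})).
have div := @completed_divergence R d (borel_lebesgue R d)
  (@borel_lebesgue_addt R d) u K p r mu_ mK K0 p0 r0.
have fp : (\int[lebesgue_Rd R d]_x `|(u x)%:E| `^ p < +oo)%E.
  have := @Lebesgue_finite _ _ _ _ _ _ u.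
  rewrite /finite_norm unlock => fp.
  rewrite ltey; apply/eqP => foo; move: fp.
  by rewrite /= foo poweRyr ?ltxx// invr_neq0// gt_eqF.
(* [K] is measurable and nonnegative, so it fails to be integrable off the ball only by having an
   infinite integral there. *)
have Koo : (\int[lebesgue_Rd R d]_(z in
    [set z | (r ^+ 2 <= \sum_(i < d) (tnth z i : R) ^+ 2)%R]) K z = +oo)%E.
  apply/eqP; rewrite -leye_eq leNgt; apply/negP => Klt; apply: rK.
  apply/integrableP; split; first exact: measurable_funTS.
  rewrite (_ : ~` Rd_ball d r = [set z | (r ^+ 2 <= \sum_(i < d) (tnth z i : R) ^+ 2)%R]).
    by under eq_integral do rewrite gee0_abs//.
  by apply/seteqP; split=> z /=; rewrite /Rd_ball/= -enorm_ge// leNgt; move/negP.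
have nu0 : ~ {ae lebesgue_Rd R d, forall x, u x = 0}.
  by move=> ux; apply: u0; apply: filterS ux => x ux _.
(* The power 1/p of [+oo] is [+oo], which contradicts the finite seminorm. *)
move: uK; rewrite /WKp/= /seminormK [X in (X `^ _)%E](div fp nu0 Koo).
by rewrite poweRyr ?ltxx// invr_neq0// gt_eqF.
Qed.
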